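(* Let $\mathrm{ZX}_{\mathsf{simp}}$ be the simplified stabilizer ZX-calculus described in the context. The copy rule (B1), i.e. the equation $$(R_Z^{(1,0)}\circ R_X^{(0,1)})\otimes(R_Z^{(1,2)}\circ R_X^{(0,1)})=R_X^{(0,1)}\otimes R_X^{(0,1)}$$ (all angles $0$), is necessary: $\mathrm{ZX}_{\mathsf{simp}}\setminus(\mathrm{B1})\not\vdash(\mathrm{B1})$. That is, this equation is not derivable from the remaining rules.
   Context: **Diagrams.** Diagrams $D:n\to m$ ($n,m\in\mathbb N$) are the morphisms of the free strict monoidal category with objects $\mathbb N$ (tensor on objects is addition) generated by: green spiders $R_Z^{(n,m)}(\alpha):n\to m$ and red spiders $R_X^{(n,m)}(\alpha):n\to m$ for all $n,m\in\mathbb N$ and $\alpha\in\{k\pi/2\mid k\in\mathbb Z\}$ (angles are real numbers, not taken modulo $2\pi$); $H:1\to1$; the swap $\sigma:2\to2$; the cup $\epsilon:2\to0$; the cap $\eta:0\to2$. The identity on $n$ is $1_n$, and $e=1_0$ is the empty diagram. $D_2\circ D_1$ means first $D_1$ then $D_2$; in $D_1\otimes D_2$, $D_1$ is on the left. Put $R_Z^{(n,m)}:=R_Z^{(n,m)}(0)$, $R_X^{(n,m)}:=R_X^{(n,m)}(0)$. **Only connectivity matters (meta rule).** $G_D=(V,E,\ell)$ has one vertex for each spider, each $H$, each input and each output of $D$, and one edge for each wire of $D$ (wires being followed through swaps, cups and caps), joining the vertices at its two ends. A green (red) spider of angle $\alpha$ is labelled $R_Z(\alpha)$ ($R_X(\alpha)$),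 an $H$ is labelled $H$, the $j$-th input (output) from the left is labelled $I_j$ ($O_j$). The order and direction in which wires are attached to a spider or $H$ is not recorded. The meta rule: $D_1=D_2$ whenever there is a bijection of the vertices of $G_{D_1}$ and $G_{D_2}$ preserving labels and the number of edges between any two (possibly equal) vertices, and the two diagrams have the same number of closed wire loops carrying no vertex. **Calculus.** For a set $R$ of rules, $R\vdash D_1=D_2$ means that $(D_1,D_2)$ belongs to the smallest equivalence relation on parallel diagrams that is closed under $\circ$ and $\otimes$ and contains all equations in $R$. $\mathrm{ZX}_{\mathsf{simp}}$ consists of the meta rule above and of the following rules; $\mathrm{ZX}_{\mathsf{simp}}\setminus(\mathrm X)$ is obtained by deleting all instances of rule (X). - (S1) for all $a,b,c,d\ge0$, $k\ge1$ and all $\alpha,\beta$: $(1_b\otimes R_Z^{(k+c,d)}(\beta))\circ(R_Z^{(a,b+k)}(\alpha)\otimes1_c)=R_Z^{(a+c,b+d)}(\alpha+\beta)$ (ordinary addition of angles). - (S3$'$L) $\eta=R_Z^{(0,2)}$; (S3$'$R) $R_Z^{(0,2)}=R_X^{(0,2)}$. - (B1) $(R_Z^{(1,0)}\circ R_X^{(0,1)})\otimes(R_Z^{(1,2)}\circ R_X^{(0,1)})=R_X^{(0,1)}\otimes R_X^{(0,1)}$. - (B2$'$) $R_Z^{(0,0)}\otimes\big[(R_X^{(2,1)}\otimes R_X^{(2,1)})\circ(1_1\otimes\sigma\otimes1_1)\circ(R_Z^{(1,2)}\otimes R_Z^{(1,2)})\big]=(R_Z^{(1,0)}\circ R_X^{(0,1)})\otimes(R_Z^{(1,2)}\circ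 R_X^{(2,1)})$. - (EU$'$) $H=R_Z^{(1,1)}(\tfrac\pi2)\circ R_X^{(2,1)}\circ(R_Z^{(0,1)}(-\tfrac\pi2)\otimes1_1)\circ R_Z^{(1,1)}(\tfrac\pi2)$. - (H) for all $n,m,\alpha$: $H^{\otimes m}\circ R_X^{(n,m)}(\alpha)\circ H^{\otimes n}=R_Z^{(n,m)}(\alpha)$. - (IV$'$) $R_Z^{(0,0)}\otimes(R_X^{(3,0)}\circ R_Z^{(0,3)})\otimes(R_X^{(3,0)}\circ R_Z^{(0,3)})=e$. - (ZO$'$) $R_Z^{(0,0)}(\pi)\otimes R_Z^{(0,1)}=R_Z^{(0,0)}(\pi)\otimes R_X^{(0,1)}$. *)

(* Defs.v *)
From HB Require Import structures.
From mathcomp Require Import all_boot all_order all_algebra.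

Set Implicit Arguments.
Unset Strict Implicit.
Unset Printing Implicit Defensive.

(** An integer [k] in angle position stands for the real angle k * pi / 2.
    Since k |-> k * pi / 2 is injective and additive, addition of angles is
    addition in [int], and angles are not identified modulo 2 * pi
    (k and k + 4 are different angles). *)
Inductive diag : nat -> nat -> Type :=
| RZ (n m : nat) (a : int) : diag n m
| RX (n m : nat) (a : int) : diag n m
| Had : diag 1 1
| Swap : diag 2 2
| Cup : diag 2 0
| Cap : diag 0 2
| Id (n : nat) : diag n n
| Comp (n m p : nat) (D2 : diag m p) (D1 : diag n m) : diag n p
| Tens (n1 m1 n2 m2 : nat) (D1 : diag n1 m1) (D2 : diag n2 m2) :
    diag (n1 + n2) (m1 + m2).

Arguments RZ (n m)%_N a%_Z.
Arguments RX (n m)%_N a%_Z.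

Declare Scope diag_scope.
Delimit Scope diag_scope with diag.
Bind Scope diag_scope with diag.
Open Scope diag_scope.

(** [D2 ∘ D1] is first [D1], then [D2]. *)
Notation "D2 ∘ D1" := (Comp D2 D1) (at level 50, left associativity)
  : diag_scope.
Notation "D1 ⊗ D2" := (Tens D1 D2) (at level 40, left associativity)
  : diag_scope.

Definition castd (n n' m m' : nat) (en : n = n') (em : m = m')
    (D : diag n m) : diag n' m' :=
  ecast k (diag k m') en (ecast k (diag n k) em D).

Definition diag_rel := forall n m : nat, diag n m -> diag n m -> Prop.

Inductive congruence_closure (R : diag_rel) : diag_rel :=
| cc_incl n m (D E : diag n m) : R n m D E -> congruence_closure R D E
| cc_refl n m (D : diag n m) : congruence_closure R D D
| cc_sym n m (D E : diag n m) :
    congruence_closure R D E -> congruence_closure R E D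
| cc_trans n m (D E F : diag n m) :
    congruence_closure R D E -> congruence_closure R E F ->
    congruence_closure R D F
| cc_comp n m p (D2 E2 : diag m p) (D1 E1 : diag n m) :
    congruence_closure R D2 E2 -> congruence_closure R D1 E1 ->
    congruence_closure R (D2 ∘ D1) (E2 ∘ E1)
| cc_tens n1 m1 n2 m2 (D1 E1 : diag n1 m1) (D2 E2 : diag n2 m2) :
    congruence_closure R D1 E1 -> congruence_closure R D2 E2 ->
    congruence_closure R (D1 ⊗ D2) (E1 ⊗ E2).

(** The terms of type [diag n m] modulo the congruence generated by these
    axioms are the morphisms n -> m of the free strict monoidal category. *)
Inductive monoidal_axiom : diag_rel :=
| ax_comp1d n m (D : diag n m) : monoidal_axiom (Id m ∘ D) D
| ax_compd1 n m (D : diag n m) : monoidal_axiom (D ∘ Id n) D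
| ax_compA n m p q (D3 : diag p q) (D2 : diag m p) (D1 : diag n m) :
    monoidal_axiom (D3 ∘ (D2 ∘ D1)) ((D3 ∘ D2) ∘ D1)
| ax_tens11 n m : monoidal_axiom (Id n ⊗ Id m) (Id (n + m))
| ax_interchange n1 m1 p1 n2 m2 p2
    (D2 : diag m1 p1) (D1 : diag n1 m1) (E2 : diag m2 p2) (E1 : diag n2 m2) :
    monoidal_axiom ((D2 ∘ D1) ⊗ (E2 ∘ E1)) ((D2 ⊗ E2) ∘ (D1 ⊗ E1))
| ax_tens1d n m (D : diag n m) : monoidal_axiom (Id 0 ⊗ D) D
| ax_tensd1 n m (D : diag n m) :
    monoidal_axiom (castd (addn0 n) (addn0 m) (D ⊗ Id 0)) D
| ax_tensA n1 m1 n2 m2 n3 m3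
    (D1 : diag n1 m1) (D2 : diag n2 m2) (D3 : diag n3 m3) :
    monoidal_axiom
      (castd (addnA n1 n2 n3) (addnA m1 m2 m3) (D1 ⊗ (D2 ⊗ D3)))
      ((D1 ⊗ D2) ⊗ D3).

(** [R ⊢ D = E]; the monoidal axioms are always available because diagrams are
    morphisms of the free strict monoidal category rather than terms. *)
Definition derives (R : diag_rel) : diag_rel :=
  congruence_closure (fun n m D E => monoidal_axiom D E \/ R n m D E).

Inductive label : Type :=
| LZ (a : int)
| LX (a : int)
| LH
| LI (j : nat)
| LO (j : nat).

(** A drawn diagram, before its wires are followed.  The wires are cut into
    elementary segments [seg]; a segment [s] has the two ends [(s, false)] and
    [(s, true)].  An end is attached to a spider or H ([inl]), to an input
    ([inr (inl i)]) or to an output ([inr (inr j)]), or to nothing ([None]) if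
    it has been joined to an end of another segment.  [glued s t] says that an
    end of [s] has been joined to an end of [t]. *)
Record drawing (n m : nat) := Drawing {
  vert : finType;
  seg : finType;
  vlabel : vert -> label;
  attached : seg * bool -> option (vert + ('I_n + 'I_m));
  glued : rel seg }.

Definition node_drawing (n m : nat) (l : label) : drawing n m :=
  @Drawing n m unit ('I_n + 'I_m)%type (fun=> l)
    (fun e => match e with
      | (inl i, false) => Some (inr (inl i))
      | (inr j, true) => Some (inr (inr j))
      | _ => Some (inl tt)
      end)
    (fun _ _ => false).

Definition id_drawing (n : nat) : drawing n n :=
  @Drawing n n void 'I_n (of_void label)
    (fun e => Some (inr (if e.2 then inr e.1 else inl e.1)))
    (fun _ _ => false).

Definition swap_drawing : drawing 2 2 :=
  @Drawing 2 2 void 'I_2 (of_void label)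
    (fun e => Some (inr (if e.2 then inr (rev_ord e.1) else inl e.1)))
    (fun _ _ => false).

Definition cup_drawing : drawing 2 0 :=
  @Drawing 2 0 void unit (of_void label)
    (fun e => Some (inr (inl (if e.2 then ord_max else ord0))))
    (fun _ _ => false).

Definition cap_drawing : drawing 0 2 :=
  @Drawing 0 2 void unit (of_void label)
    (fun e => Some (inr (inr (if e.2 then ord_max else ord0))))
    (fun _ _ => false).

Definition joint (n m p : nat) (G2 : drawing m p) (G1 : drawing n m)
    (s1 : seg G1) (s2 : seg G2) : bool :=
  [exists j : 'I_m, exists b1 : bool, exists b2 : bool,
    (attached (s1, b1) == Some (inr (inr j))) &&
    (attached (s2, b2) == Some (inr (inl j)))].

Definition comp_drawing (n m p : nat) (G2 : drawing m p) (G1 : drawing n m) :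
    drawing n p :=
  @Drawing n p (vert G1 + vert G2)%type (seg G1 + seg G2)%type
    (fun v => match v with inl v1 => vlabel v1 | inr v2 => vlabel v2 end)
    (fun e => match e with
      | (inl s1, b) =>
          match attached (s1, b) with
          | Some (inl v) => Some (inl (inl v))
          | Some (inr (inl i)) => Some (inr (inl i))
          | Some (inr (inr _)) | None => None
          end
      | (inr s2, b) =>
          match attached (s2, b) with
          | Some (inl v) => Some (inl (inr v))
          | Some (inr (inr j)) => Some (inr (inr j))
          | Some (inr (inl _)) | None => None
          end
      end)
    (fun s t => match s, t with
      | inl s1, inl t1 => glued s1 t1
      | inr s2, inr t2 => glued s2 t2
      | inl s1, inr t2 => joint s1 t2
      | inr s2, inl t1 => joint t1 s2
      end).

Definition tens_drawing (n1 m1 n2 m2 : nat)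
    (G1 : drawing n1 m1) (G2 : drawing n2 m2) : drawing (n1 + n2) (m1 + m2) :=
  @Drawing (n1 + n2) (m1 + m2) (vert G1 + vert G2)%type (seg G1 + seg G2)%type
    (fun v => match v with inl v1 => vlabel v1 | inr v2 => vlabel v2 end)
    (fun e => match e with
      | (inl s1, b) =>
          omap (fun x => match x with
            | inl v => inl (inl v)
            | inr (inl i) => inr (inl (lshift n2 i))
            | inr (inr j) => inr (inr (lshift m2 j))
            end) (attached (s1, b))
      | (inr s2, b) =>
          omap (fun x => match x with
            | inl v => inl (inr v)
            | inr (inl i) => inr (inl (rshift n1 i))
            | inr (inr j) => inr (inr (rshift m1 j))
            end) (attached (s2, b))
      end)
    (fun s t => match s, t with
      | inl s1, inl t1 => glued s1 t1
      | inr s2, inr t2 => glued s2 t2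
      | _, _ => false
      end).

Fixpoint draw (n m : nat) (D : diag n m) : drawing n m :=
  match D in diag n m return drawing n m with
  | RZ n m a => node_drawing n m (LZ a)
  | RX n m a => node_drawing n m (LX a)
  | Had => node_drawing 1 1 LH
  | Swap => swap_drawing
  | Cup => cup_drawing
  | Cap => cap_drawing
  | Id n => id_drawing n
  | Comp _ _ _ D2 D1 => comp_drawing (draw D2) (draw D1)
  | Tens _ _ _ _ D1 D2 => tens_drawing (draw D1) (draw D2)
  end.

Section Graph.
Variables (n m : nat) (D : diag n m).

Definition vertex : finType := (vert (draw D) + ('I_n + 'I_m))%type.

Definition vertex_label (v : vertex) : label :=
  match v with
  | inl u => vlabel u
  | inr (inl i) => LI i
  | inr (inr j) => LO j
  end.

Definition wires : {set {set seg (draw D)}} :=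
  equivalence_partition (connect (@glued n m (draw D))) [set: seg (draw D)].

(** A wire that is not a closed loop has exactly two attached ends. *)
Definition joins (w : {set seg (draw D)}) (u v : vertex) : bool :=
  [exists e : seg (draw D) * bool, exists f : seg (draw D) * bool,
    [&& e != f, e.1 \in w, f.1 \in w,
        attached e == Some u & attached f == Some v]].

Definition nb_edges (u v : vertex) : nat := #|[set w in wires | joins w u v]|.

Definition nb_loops : nat :=
  #|[set w in wires |
      [forall e : seg (draw D) * bool,
        (e.1 \in w) ==> (attached e == None)]]|.

End Graph.

Definition same_connectivity (n m : nat) (D E : diag n m) : Prop :=
  (exists f : vertex D -> vertex E,
    [/\ bijective f,
        forall v, vertex_label (f v) = vertex_label v
      & forall u v, nb_edges (f u) (f v) = nb_edges u v]) /\
  nb_loops D = nb_loops E.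

Fixpoint Had_pow (n : nat) : diag n n :=
  if n is n'.+1 then (Had ⊗ Had_pow n')%diag else Id 0.

Inductive rule_name : Type :=
| Meta | S1 | S3L | S3R | B1 | B2 | EU | HR | IV | ZO.

Inductive rule : rule_name -> diag_rel :=
| rule_Meta n m (D E : diag n m) : same_connectivity D E -> rule Meta D E
| rule_S1 (a b c d k : nat) (x y : int) : 0 < k ->
    rule S1
      ((Id b ⊗ RZ (k + c) d y)
         ∘ castd (erefl (a + c)) (esym (addnA b k c)) (RZ a (b + k) x ⊗ Id c))
      (RZ (a + c) (b + d) (x + y)%R)
| rule_S3L : rule S3L Cap (RZ 0 2 0)
| rule_S3R : rule S3R (RZ 0 2 0) (RX 0 2 0)
| rule_B1 :
    @rule B1 0 2
      ((RZ 1 0 0 ∘ RX 0 1 0) ⊗ (RZ 1 2 0 ∘ RX 0 1 0))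
      (RX 0 1 0 ⊗ RX 0 1 0)
| rule_B2 :
    @rule B2 2 2
      (RZ 0 0 0 ⊗ ((RX 2 1 0 ⊗ RX 2 1 0)
                     ∘ (Id 1 ⊗ Swap ⊗ Id 1)
                     ∘ (RZ 1 2 0 ⊗ RZ 1 2 0)))
      ((RZ 1 0 0 ∘ RX 0 1 0) ⊗ (RZ 1 2 0 ∘ RX 2 1 0))
| rule_EU :
    rule EU Had
      (RZ 1 1 1 ∘ RX 2 1 0 ∘ (RZ 0 1 (-1) ⊗ Id 1) ∘ RZ 1 1 1)
| rule_HR (n m : nat) (x : int) :
    rule HR (Had_pow m ∘ RX n m x ∘ Had_pow n) (RZ n m x)
| rule_IV :
    @rule IV 0 0
      (RZ 0 0 0 ⊗ (RX 3 0 0 ∘ RZ 0 3 0) ⊗ (RX 3 0 0 ∘ RZ 0 3 0))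
      (Id 0)
| rule_ZO :
    @rule ZO 0 1 (RZ 0 0 2 ⊗ RZ 0 1 0) (RZ 0 0 2 ⊗ RX 0 1 0).

Definition ZXsimp : diag_rel := fun n m D E => exists r, @rule r n m D E.

Definition ZXsimp_without (r0 : rule_name) : diag_rel :=
  fun n m D E => exists2 r, r <> r0 & @rule r n m D E.

(* Main.v *)
From Stdlib Require Import Setoid FunctionalExtensionality.
Require Import Defs.
From mathcomp Require Import all_boot all_order all_algebra.

Set Implicit Arguments.
Unset Strict Implicit.
Unset Printing Implicit Defensive.

(** Every rule except (B1) preserves the partition of the inputs and outputs
    induced by the connected components of the diagram, whereas (B1) separates
    two connected outputs.  The partition is encoded functorially, as the
    relation formed by the boolean colourings of the boundary that extend to a
    colouring constant on each component: all spiders and H become the relation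
    "all legs have the same colour", and diagrams compose as relations. *)

(** * Splitting and concatenating families indexed by a sum *)

Definition lpart {A : Type} {n m : nat} (x : 'I_(n + m) -> A) : 'I_n -> A :=
  x \o lshift m.

Definition rpart {A : Type} {n m : nat} (x : 'I_(n + m) -> A) : 'I_m -> A :=
  x \o @rshift n m.

Definition join {A : Type} {n m : nat} (x : 'I_n -> A) (y : 'I_m -> A) :
    'I_(n + m) -> A :=
  fun i => match split i with inl j => x j | inr k => y k end.

Lemma lpart_join A n m (x : 'I_n -> A) (y : 'I_m -> A) : lpart (join x y) = x.
Proof.
by apply: functional_extensionality => i; rewrite /lpart /join /= (unsplitK (inl i)).
Qed.

Lemma rpart_join A n m (x : 'I_n -> A) (y : 'I_m -> A) : rpart (join x y) = y.
Proof.
by apply: functional_extensionality => i; rewrite /rpart /join /= (unsplitK (inr i)).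
Qed.

Lemma eq_parts A n m (x y : 'I_(n + m) -> A) :
  lpart x = lpart y -> rpart x = rpart y -> x = y.
Proof.
move=> el er; apply: functional_extensionality => i.
by case: (split_ordP i) => j ->;
  [apply: (congr1 (@^~ j) el) | apply: (congr1 (@^~ j) er)].
Qed.

(** * Colouring relations and the monoidal axioms *)

(** The colour [v] is quantified existentially, so a spider without legs imposes no constraint and
    scalars such as [RZ 0 0 a] become the true relation. *)
Definition monochrome n m (x : 'I_n -> bool) (y : 'I_m -> bool) : Prop :=
  exists v, (forall i, x i = v) /\ (forall j, y j = v).

Fixpoint coloring n m (D : diag n m) : ('I_n -> bool) -> ('I_m -> bool) -> Prop :=
  match D in diag n m return ('I_n -> bool) -> ('I_m -> bool) -> Prop with
  | RZ n m _ | RX n m _ => @monochrome n m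
  | Had => @monochrome 1 1
  | Swap => fun x y => y = x \o @rev_ord 2
  | Cup => fun x _ => x ord0 = x ord_max
  | Cap => fun _ y => y ord0 = y ord_max
  | Id n => fun x y => x = y
  | Comp _ _ _ D2 D1 => fun x y => exists2 z, coloring D1 x z & coloring D2 z y
  | Tens _ _ _ _ D1 D2 => fun x y =>
      coloring D1 (lpart x) (lpart y) /\ coloring D2 (rpart x) (rpart y)
  end.

Definition same_coloring : diag_rel :=
  fun n m D E => forall x y, coloring D x y <-> coloring E x y.

Lemma same_coloring_closure (R : diag_rel) :
  (forall n m (D E : diag n m), R n m D E -> same_coloring D E) ->
  forall n m (D E : diag n m), congruence_closure R D E -> same_coloring D E.
Proof.
move=> RS n m D E; elim=> {n m D E}.
- exact: RS.
- by [].
- by move=> n m D E _ DE x y; case: (DE x y); split.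
- by move=> n m D E F _ DE _ EF x y; apply: iff_trans (DE x y) (EF x y).
- move=> n m p D2 E2 D1 E1 _ e2 _ e1 x y /=.
  by split=> -[z /e1 h1 /e2 h2]; exists z.
- by move=> n1 m1 n2 m2 D1 E1 D2 E2 _ e1 _ e2 x y /=; split=> -[/e1 h1 /e2 h2].
Qed.

Lemma coloring_castd n n' m m' (en : n = n') (em : m = m') (D : diag n m) x y :
  coloring (castd en em D) x y <-> coloring D (x \o cast_ord en) (y \o cast_ord em).
Proof.
case: n' / en x; case: m' / em y => y x /=.
have id_cast k (z : 'I_k -> bool) : z \o cast_ord (erefl k) = z.
  by apply: functional_extensionality => i /=; rewrite cast_ord_id.
by rewrite !id_cast.
Qed.

(** Relations between families of colours form a monoidal category under composition and
    juxtaposition. The casts in the unit and associativity laws only reindex the boundary, so both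
    sides read each port at the same numerical index. *)
Lemma monoidal_same_coloring n m (D E : diag n m) :
  monoidal_axiom D E -> same_coloring D E.
Proof.
case=> {n m D E}.
- by move=> n m D x y /=; split=> [[z h <-]|h]; [|exists y].
- by move=> n m D x y /=; split=> [[z <- h]|h]; [|exists x].
- move=> n m p q D3 D2 D1 x y /=; split.
    by case=> z [t h1 h2] h3; exists t => //; exists z.
  by case=> z h1 [t h2 h3]; exists t => //; exists z.
- by move=> n m x y /=; split=> [[]|->//]; apply: eq_parts.
- move=> n1 m1 p1 n2 m2 p2 D2 D1 E2 E1 x y /=; split.
    (* The middle boundary of the right-hand side is the concatenation of the two middle boundaries
       on the left. *)
    case=> -[z h1 h2] [t h3 h4]; exists (join z t);
    by rewrite !(lpart_join, rpart_join).
  by case=> z [h1 h3] [h2 h4]; split; [exists (lpart z) | exists (rpart z)].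
- move=> n m D x y /=.
  have rpart0 k (z : 'I_(0 + k) -> bool) : rpart z = z.
    by apply: functional_extensionality => i; congr z; apply: val_inj.
  rewrite !rpart0; split=> [[]//|h]; split=> //.
  by apply: functional_extensionality => -[].
- move=> n m D x y; rewrite coloring_castd /=.
  have lpart0 k (z : 'I_k -> bool) : lpart (z \o cast_ord (addn0 k)) = z.
    by apply: functional_extensionality => i; congr z; apply: val_inj.
  rewrite !lpart0; split=> [[]//|h]; split=> //.
  by apply: functional_extensionality => -[].
- move=> n1 m1 n2 m2 n3 m3 D1 D2 D3 x y; rewrite coloring_castd /=.
  have l k1 k2 k3 (z : 'I_(k1 + k2 + k3) -> bool) :
      lpart (z \o cast_ord (addnA k1 k2 k3)) = lpart (lpart z).
    by apply: functional_extensionality => i; congr z; apply: val_inj.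
  have lr k1 k2 k3 (z : 'I_(k1 + k2 + k3) -> bool) :
      lpart (rpart (z \o cast_ord (addnA k1 k2 k3))) = rpart (lpart z).
    by apply: functional_extensionality => i; congr z; apply: val_inj.
  have r k1 k2 k3 (z : 'I_(k1 + k2 + k3) -> bool) :
      rpart (rpart (z \o cast_ord (addnA k1 k2 k3))) = rpart z.
    by apply: functional_extensionality => i; congr z; apply: val_inj; rewrite /= addnA.
  by rewrite !(l, lr, r); tauto.
Qed.

(** * Colourings of drawings *)

Definition port_color V n m (cv : V -> bool) (x : 'I_n -> bool) (y : 'I_m -> bool)
    (p : V + ('I_n + 'I_m)) : bool :=
  match p with inl v => cv v | inr (inl i) => x i | inr (inr j) => y j end.

(** Constancy on wires is imposed locally, at attached ends and at glued segments. No wire has to be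
    followed, so the notion is compatible with the recursive construction of drawings. *)
Definition drawing_coloring n m (G : drawing n m) (x : 'I_n -> bool)
    (y : 'I_m -> bool) : Prop :=
  exists (c : seg G -> bool) (cv : vert G -> bool),
    (forall s b p, attached (s, b) = Some p -> port_color cv x y p = c s) /\
    (forall s t, glued s t -> c s = c t).

(** An arbitrary [drawing] may leave a port untouched; those coming from diagrams do not. Together
    with the analogue for outputs, this lets colours pass through every middle port of a
    composition. *)
Lemma input_attached n m (D : diag n m) (i : 'I_n) :
  exists e : seg (draw D) * bool, attached e = Some (inr (inl i)).
Proof.
elim: D i => {n m} /=.
- by move=> n m _ i; exists (inl i, false).
- by move=> n m _ i; exists (inl i, false).
- by move=> i; exists (inl i, false).
- by move=> i; exists (i, false).
(* The cup is a single segment, whose end [false] sits at input 0 and whose end [true] sits at input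
   1. *)
- move=> i; exists (tt, i == ord_max) => /=; congr (Some (inr (inl _))).
  by apply: val_inj; case: i => -[|[|]].
- by case.
- by move=> n i; exists (i, false).
- move=> n m p D2 _ D1 IH i; have [[s b] /= e] := IH i.
  by exists (inl s, b); rewrite e.
- move=> n1 m1 n2 m2 D1 IH1 D2 IH2 i.
  case: (split_ordP i) => j ->.
    by have [[s b] /= e] := IH1 j; exists (inl s, b); rewrite /= e.
  by have [[s b] /= e] := IH2 j; exists (inr s, b); rewrite /= e.
Qed.

Lemma output_attached n m (D : diag n m) (j : 'I_m) :
  exists e : seg (draw D) * bool, attached e = Some (inr (inr j)).
Proof.
elim: D j => {n m} /=.
- by move=> n m _ i; exists (inr i, true).
- by move=> n m _ i; exists (inr i, true).
- by move=> i; exists (inr i, true).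
- by move=> i; exists (rev_ord i, true); rewrite /= rev_ordK.
- by case.
- move=> i; exists (tt, i == ord_max) => /=; congr (Some (inr (inr _))).
  by apply: val_inj; case: i => -[|[|]].
- by move=> n i; exists (i, true).
- move=> n m p D2 IH D1 _ i; have [[s b] /= e] := IH i.
  by exists (inr s, b); rewrite e.
- move=> n1 m1 n2 m2 D1 IH1 D2 IH2 i.
  case: (split_ordP i) => j ->.
    by have [[s b] /= e] := IH1 j; exists (inl s, b); rewrite /= e.
  by have [[s b] /= e] := IH2 j; exists (inr s, b); rewrite /= e.
Qed.

Lemma glued_sym n m (D : diag n m) : symmetric (@glued n m (draw D)).
Proof.
elim: D => {n m} //=.
- by move=> n m p D2 IH2 D1 IH1 [s|s] [t|t] /=.
- by move=> n1 m1 n2 m2 D1 IH1 D2 IH2 [s|s] [t|t] /=.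
Qed.

Lemma node_drawing_coloring n m l x y :
  monochrome x y <-> drawing_coloring (node_drawing n m l) x y.
Proof.
split=> [[v [xv yv]]|[c [cv [h _]]]].
  exists (fun=> v), (fun=> v); split=> // s b p.
  by case: s b => [i|j] [] /= [<-] /=.
exists (cv tt); split=> i.
  by have /= -> := h (inl i) true _ erefl; apply: (h (inl i) false (inr (inl i))).
by have /= -> := h (inr i) false _ erefl; apply: (h (inr i) true (inr (inr i))).
Qed.

Lemma jointP n m p (G2 : drawing m p) (G1 : drawing n m) (s1 : seg G1) (s2 : seg G2) :
  reflect (exists j b1 b2, attached (s1, b1) = Some (inr (inr j)) /\
                           attached (s2, b2) = Some (inr (inl j)))
          (joint s1 s2).
Proof.
apply: (iffP existsP) => [[j /existsP[b1 /existsP[b2 /andP[/eqP e1 /eqP e2]]]]|].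
  by exists j, b1, b2.
case=> j [b1 [b2 [e1 e2]]]; exists j; apply/existsP; exists b1; apply/existsP.
by exists b2; rewrite e1 e2 !eqxx.
Qed.

(** Two colourings with the same middle values agree across each joint, hence combine. Conversely,
    the middle value at [j] is the colour of a chosen segment of [D1] ending at output [j], and the
    joints make every other segment at that port agree with it. *)
Lemma comp_drawing_coloring n m p (D2 : diag m p) (D1 : diag n m) x y :
  (exists2 z, drawing_coloring (draw D1) x z & drawing_coloring (draw D2) z y) <->
  drawing_coloring (comp_drawing (draw D2) (draw D1)) x y.
Proof.
split.
  case=> z [c1 [v1 [a1 g1]]] [c2 [v2 [a2 g2]]].
  exists (fun s => match s with inl s => c1 s | inr s => c2 s end).
  exists (fun s => match s with inl s => v1 s | inr s => v2 s end).
  have J s t : joint s t -> c1 s = c2 t.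
    by case/jointP=> j [b1 [b2 [/a1 /= <- /a2 /= <-]]].
  split.
    move=> [s|s] b q /=; case e: attached => [[v|[i|j]]|] //= [<-] /=.
    - exact: (a1 _ _ _ e).
    - exact: (a1 _ _ _ e).
    - exact: (a2 _ _ _ e).
    - exact: (a2 _ _ _ e).
  by move=> [s|s] [t|t] /=; [exact: g1 | exact: J | move/J | exact: g2].
case=> c [cv [a g]].
have fP j : exists s : seg (draw D1),
    [exists b, attached (s, b) == Some (inr (inr j))].
  by have [[s b] /eqP e] := output_attached D1 j; exists s; apply/existsP; exists b.
pose f j := xchoose (fP j).
have fE j : exists b, attached (f j, b) = Some (inr (inr j)).
  by have /existsP[b /eqP e] := xchooseP (fP j); exists b.
have zE s2 b j : attached (s2, b) = Some (inr (inl j)) -> c (inl (f j)) = c (inr s2).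
  by move=> e; apply: g => /=; apply/jointP; have [b1 e1] := fE j; exists j, b1, b.
exists (fun j => c (inl (f j))).
  exists (fun s => c (inl s)), (fun v => cv (inl v)); split=> [s b q e|s t]; last first.
    exact: (g (inl s) (inl t)).
  case: q e => [v|[i|j]] e /=.
  - by have /= := a (inl s) b (inl (inl v)); rewrite e => <-.
  - by have /= := a (inl s) b (inr (inl i)); rewrite e => <-.
  - have [[s2 b2] e2] := input_attached D2 j.
    rewrite (zE _ _ _ e2); symmetry; apply: g => /=; apply/jointP.
    by exists j, b, b2.
exists (fun s => c (inr s)), (fun v => cv (inr v)); split=> [s b q e|s t]; last first.
  exact: (g (inr s) (inr t)).
case: q e => [v|[i|j]] e /=.
- by have /= := a (inr s) b (inl (inr v)); rewrite e => <-.
- exact: zE e.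
- by have /= := a (inr s) b (inr (inr j)); rewrite e => <-.
Qed.

Lemma tens_drawing_coloring n1 m1 n2 m2 (G1 : drawing n1 m1) (G2 : drawing n2 m2) x y :
  (drawing_coloring G1 (lpart x) (lpart y) /\
   drawing_coloring G2 (rpart x) (rpart y)) <->
  drawing_coloring (tens_drawing G1 G2) x y.
Proof.
split.
  case=> -[c1 [v1 [a1 g1]]] [c2 [v2 [a2 g2]]].
  exists (fun s => match s with inl s => c1 s | inr s => c2 s end).
  exists (fun s => match s with inl s => v1 s | inr s => v2 s end).
  split; last by move=> [s|s] [t|t] //=; [exact: g1 | exact: g2].
  move=> [s|s] b q /=; case e: attached => [[v|[i|j]]|] //= [<-] /=.
  - exact: (a1 _ _ _ e).
  - exact: (a1 _ _ _ e).
  - exact: (a1 _ _ _ e).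
  - exact: (a2 _ _ _ e).
  - exact: (a2 _ _ _ e).
  - exact: (a2 _ _ _ e).
case=> c [cv [a g]]; split.
  exists (fun s => c (inl s)), (fun v => cv (inl v)); split=> [s b q e|s t]; last first.
    exact: (g (inl s) (inl t)).
  have /= := a (inl s) b; rewrite e /= => /(_ _ erefl) <-.
  by case: q e => [v|[i|j]].
exists (fun s => c (inr s)), (fun v => cv (inr v)); split=> [s b q e|s t]; last first.
  exact: (g (inr s) (inr t)).
have /= := a (inr s) b; rewrite e /= => /(_ _ erefl) <-.
by case: q e => [v|[i|j]].
Qed.

Lemma draw_coloring n m (D : diag n m) x y :
  coloring D x y <-> drawing_coloring (draw D) x y.
Proof.
elim: D x y => {n m}.
- by move=> n m a x y; apply: node_drawing_coloring.
- by move=> n m a x y; apply: node_drawing_coloring.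
- by move=> x y; apply: node_drawing_coloring.
- move=> x y /=; split=> [->|[c [cv [a _]]]].
    exists x, (of_void bool); split=> // s [] p /= [<-] //=.
    by rewrite rev_ordK.
  apply: functional_extensionality => i /=.
  have := a (rev_ord i) true _ erefl; rewrite /= rev_ordK => ->.
  by have /= -> := a (rev_ord i) false _ erefl.
- move=> x y /=; split=> [e|[c [cv [a _]]]].
    by exists (fun=> x ord0), (of_void bool); split=> // s [] p /= [<-].
  by have /= -> := a tt false _ erefl; have /= -> := a tt true _ erefl.
- move=> x y /=; split=> [e|[c [cv [a _]]]].
    by exists (fun=> y ord0), (of_void bool); split=> // s [] p /= [<-].
  by have /= -> := a tt false _ erefl; have /= -> := a tt true _ erefl.
- move=> n x y /=; split=> [->|[c [cv [a _]]]].
    by exists y, (of_void bool); split=> // s [] p /= [<-].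
  apply: functional_extensionality => i.
  by have /= -> := a i false _ erefl; have /= -> := a i true _ erefl.
- move=> n m p D2 IH2 D1 IH1 x y; rewrite /= -comp_drawing_coloring.
  by split=> -[z /IH1 h1 /IH2 h2]; exists z.
- move=> n1 m1 n2 m2 D1 IH1 D2 IH2 x y /=.
  by rewrite -tens_drawing_coloring IH1 IH2.
Qed.

(** * Colourings of the labelled graph and the meta rule *)

Lemma connect_eq (T : finType) (e : rel T) (A : Type) (c : T -> A) :
  (forall s t, e s t -> c s = c t) -> forall s t, connect e s t -> c s = c t.
Proof.
move=> ec s t /connectP[p]; elim: p s => [|u p IH] s /= => [_ ->//|].
by case/andP=> /ec -> /IH.
Qed.

Lemma nb_edgesP n m (D : diag n m) (u v : vertex D) :
  reflect (exists s : seg (draw D), exists e f : seg (draw D) * bool,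
             [/\ e != f, connect (@glued n m (draw D)) s e.1,
                 connect (@glued n m (draw D)) s f.1,
                 attached e = Some u & attached f = Some v])
          (0 < nb_edges u v).
Proof.
apply: (iffP card_gt0P) => [[w]|[s [e [f [ef se sf eu fv]]]]].
  rewrite inE => /andP[/imsetP[s _ ->]].
  case/existsP=> e /existsP[f /and5P[ef]].
  by rewrite !inE /= => se sf /eqP eu /eqP fv; exists s, e, f.
exists [set t in [set: seg (draw D)] | connect (@glued n m (draw D)) s t].
rewrite inE; apply/andP; split; first exact: imset_f.
apply/existsP; exists e; apply/existsP; exists f.
by rewrite !inE /= ef se sf eu fv !eqxx.
Qed.

(** This makes the relation an invariant of the labelled graph: only adjacency of vertices enters.
    Given a vertex colouring, each wire takes the colour of a vertex at one of its ends, and any two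
    distinct attached ends of a wire witness an edge. *)
Lemma graph_coloring n m (D : diag n m) x y :
  coloring D x y <->
  exists c : vertex D -> bool,
    [/\ forall i, c (inr (inl i)) = x i, forall j, c (inr (inr j)) = y j
      & forall u v, 0 < nb_edges u v -> c u = c v].
Proof.
rewrite draw_coloring; split.
  case=> c [cv [a g]]; exists (port_color cv x y); split=> // u v.
  case/nb_edgesP=> s [[e be] [[f bf] [_ /= se sf eu fv]]].
  by rewrite (a _ _ _ eu) (a _ _ _ fv) -(connect_eq g se) -(connect_eq g sf).
case=> c [cx cy cE].
pose end_of s (e : seg (draw D) * bool) :=
  connect (@glued n m (draw D)) s e.1 && (attached e != None).
(* A wire without attached ends is a closed loop and receives the default [false]; the inner default
   is never reached, since [end_of] demands an attached end. *)
pose cs s := if [pick e | end_of s e] is Some e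
             then if attached e is Some u then c u else false else false.
exists cs, (c \o inl); split; last first.
  (* Glued segments lie in the same class, so [pick] searches the same set of ends for both. *)
  move=> s t st; rewrite /cs; congr (if _ is Some e then _ else _).
  apply: eq_pick => e; rewrite /end_of; congr (_ && _).
  apply: same_connect; last exact: connect1.
  exact/sym_connect_sym/glued_sym.
move=> s b p e.
have -> : port_color (c \o inl) x y p = c p by case: p e => [v|[i|j]] _ /=.
rewrite /cs; case: pickP => [f /andP[/= sf]|/(_ (s, b))]; last first.
  by rewrite /end_of connect0 e.
case E: (attached f) => [u|] // _.
have [ef|ef] := eqVneq (s, b) f; first by move: E; rewrite -ef e => -[->].
by apply: cE; apply/nb_edgesP; exists s, (s, b), f; rewrite connect0.
Qed.

(** Input and output labels thus occur only on boundary vertices, which forces a label-preserving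
    map to send each port to the port with the same index. *)
Lemma vlabel_not_port n m (D : diag n m) (v : vert (draw D)) :
  match vlabel v with LI _ | LO _ => False | _ => True end.
Proof. by elim: D v => {n m} //= [? ? ? ? IH ? IH'|? ? ? ? ? IH' ? IH] []. Qed.

(** Composing a vertex colouring of [E] with [f] keeps the boundary values because labels identify
    the ports, and respects edges because [f] preserves adjacency. *)
Lemma coloring_pullback n m (D E : diag n m) (f : vertex D -> vertex E) x y :
  (forall v, vertex_label (f v) = vertex_label v) ->
  (forall u v, nb_edges (f u) (f v) = nb_edges u v) ->
  coloring E x y -> coloring D x y.
Proof.
move=> fl fe /graph_coloring[c [cx cy cE]].
apply/graph_coloring; exists (c \o f); split=> [i|j|u v uv] /=.
- have := fl (inr (inl i)); case: (f _) => [v|[k|k]] //= e.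
    by have := vlabel_not_port v; rewrite e.
  by rewrite cx; congr x; apply: val_inj; case: e.
- have := fl (inr (inr j)); case: (f _) => [v|[k|k]] //= e.
    by have := vlabel_not_port v; rewrite e.
  by rewrite cy; congr y; apply: val_inj; case: e.
- by apply: cE; rewrite fe.
Qed.

Lemma same_connectivity_coloring n m (D E : diag n m) :
  same_connectivity D E -> same_coloring D E.
Proof.
case=> -[f [[g fK gK] fl fe]] _ x y; split; last exact: coloring_pullback.
apply: (@coloring_pullback _ _ _ _ g) => [v|u v]; first by rewrite -fl gK.
by rewrite -fe !gK.
Qed.

(** * The remaining rules *)

(** A two-legged monochrome node is the identity relation, so the colour change rule [HR] only
    compares [RX] with [RZ], whose relations coincide. *)
Lemma Had_pow_coloring n x y : coloring (Had_pow n) x y <-> x = y.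
Proof.
elim: n x y => [|n IH] x y //=; split=> [[[v [xv yv]] /IH e]|->].
  by apply: (@eq_parts _ 1 n) => //; apply: functional_extensionality => i;
    rewrite xv yv.
by split; [exists (@lpart _ 1 n y ord0); split=> i; rewrite (ord1 i) | apply/IH].
Qed.

Lemma eq_at A n (z : 'I_n -> A) (i j : 'I_n) : val i = val j -> z i = z j.
Proof. by move/val_inj->. Qed.

Lemma S1_coloring (a b c d k : nat) (x y : int) : 0 < k ->
  same_coloring
    ((Id b ⊗ RZ (k + c) d y)
       ∘ castd (erefl (a + c)) (esym (addnA b k c)) (RZ a (b + k) x ⊗ Id c))
    (RZ (a + c) (b + d) (x + y)%R).
Proof.
case: k => // k _ s t; split; last first.
  case=> v [sv tv]; exists (fun=> v).
    apply/coloring_castd; split; first by exists v; split=> // i; apply: sv.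
    by apply: functional_extensionality => i; rewrite /rpart /= sv.
  split; last by exists v; split=> // i; apply: tv.
  by apply: functional_extensionality => i; rewrite /lpart /= tv.
case=> z /coloring_castd /= [[v [sv zv]] zs] [zt [w [zw tw]]].
(* Since at least one wire links the two spiders, their colours are compared on the first such wire,
   at position [b] of the middle boundary. *)
have vw : v = w.
  rewrite -(zv (rshift b ord0)) -(zw (lshift c ord0)).
  by rewrite /lpart /rpart /=; congr z; apply: val_inj.
exists v; split=> i; case: (split_ordP i) => j ->.
- by rewrite -(sv j) /lpart /=; congr s; apply: val_inj.
(* The last [c] inputs bypass the first spider and arrive at the last [c] legs of the second. *)
- have -> : s (rshift a j) = z (rshift b (rshift k.+1 j)).
    apply: etrans (etrans _ (congr1 (@^~ j) zs)) _;
      rewrite /rpart /=; apply: eq_at => //=.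
    by rewrite addnA.
  by rewrite vw; apply: zw.
- have /= := congr1 (@^~ j) zt; rewrite /lpart /= => <-.
  by rewrite -(zv (lshift _ j)) /lpart /=; congr z; apply: val_inj.
- by rewrite vw; apply: tw.
Qed.

(** The four spiders on the left form a 4-cycle, so both sides force all inputs and outputs to share
    one colour, and the scalar factors are always satisfiable. *)
Lemma B2_coloring :
  @same_coloring 2 2
    (RZ 0 0 0 ⊗ ((RX 2 1 0 ⊗ RX 2 1 0) ∘ (Id 1 ⊗ Swap ⊗ Id 1)
                   ∘ (RZ 1 2 0 ⊗ RZ 1 2 0)))
    ((RZ 1 0 0 ∘ RX 0 1 0) ⊗ (RZ 1 2 0 ∘ RX 2 1 0)).
Proof.
have part0 (z : 'I_(0 + 2) -> bool) : rpart z = z.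
  by apply: functional_extensionality => i; congr z; apply: val_inj.
move=> x y /=; rewrite !part0; split; last first.
  case=> _ [z [v [xv zv]] [w [zw yw]]].
  have vw : v = w by rewrite -(zv ord0) zw.
  subst w; split; first by exists v; split=> -[].
  exists (fun=> v); first by split; exists v; split=> // i; apply: xv.
  exists (fun=> v); last by split; exists v; split=> // i; apply: yw.
  by split=> //; split=> //; apply: functional_extensionality.
case=> _ [z [[v1 [xv1 zv1]] [v2 [xv2 zv2]]] [t [[zt0 zt12] _]]].
case=> [[w1 [tw1 yw1]] [w2 [tw2 yw2]]].
(* The four middle wires are addressed by position, with colours [z] before the swap and [t] after
   it; the swap exchanges positions 1 and 2. *)
pose o k (lk : k < 4) := @Ordinal 4 k lk.
have z0t0 : z (o 0 isT) = t (o 0 isT).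
  by apply: etrans (etrans _ (congr1 (@^~ ord0) zt0)) _;
    rewrite /lpart /rpart /=; apply: eq_at.
have t1z2 : t (o 1 isT) = z (o 2 isT).
  by apply: etrans (etrans _ (congr1 (@^~ ord0) zt12)) _;
    rewrite /lpart /rpart /=; apply: eq_at.
have t2z1 : t (o 2 isT) = z (o 1 isT).
  by apply: etrans (etrans _ (congr1 (@^~ ord_max) zt12)) _;
    rewrite /lpart /rpart /=; apply: eq_at.
rewrite /lpart /rpart /= in zv1 zv2 tw1 tw2.
have z0 : z (o 0 isT) = v1 by apply: etrans (zv1 ord0); apply: eq_at.
have z1 : z (o 1 isT) = v1 by apply: etrans (zv1 ord_max); apply: eq_at.
have z2 : z (o 2 isT) = v2 by apply: etrans (zv2 ord0); apply: eq_at.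
have t0 : t (o 0 isT) = w1 by apply: etrans (tw1 ord0); apply: eq_at.
have t1 : t (o 1 isT) = w1 by apply: etrans (tw1 ord_max); apply: eq_at.
have t2 : t (o 2 isT) = w2 by apply: etrans (tw2 ord0); apply: eq_at.
(* Three wires form a path through all four spiders: [v2] to [w1] to [v1] to [w2]. *)
have w1E : w1 = v1 by rewrite -t0 -z0t0.
have v2E : v2 = v1 by rewrite -z2 -t1z2 t1.
have w2E : w2 = v1 by rewrite -t2 t2z1.
rewrite v2E in xv2; rewrite w1E in yw1; rewrite w2E in yw2.
split.
  exists (fun=> true); first by exists true; split=> // -[].
  by exists true; split=> // -[].
exists (fun=> v1); exists v1; split=> // i.
- by case: (@split_ordP 1 1 i) => j ->;
    [rewrite -(xv1 j) | rewrite -(xv2 j)]; apply: eq_at.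
- by case: (@split_ordP 1 1 i) => j ->;
    [rewrite -(yw1 j) | rewrite -(yw2 j)]; apply: eq_at.
Qed.

(** The spider of angle -1 is a dangling branch on the red one; the path from input to output stays
    connected, as for [Had]. *)
Lemma EU_coloring :
  same_coloring Had (RZ 1 1 1 ∘ RX 2 1 0 ∘ (RZ 0 1 (-1) ⊗ Id 1) ∘ RZ 1 1 1).
Proof.
move=> x y /=; split.
  case=> v [xv yv]; exists (fun=> v); first by exists v.
  exists (fun=> v).
    by split; [exists v; split=> // -[] | apply: functional_extensionality].
  by exists (fun=> v); exists v.
case=> a [v [xv av]] [b [_ ab] [c [w [bw cw]] [u [cu yu]]]].
have vw : v = w.
  (* The identity wire lies to the right of the branch, hence it enters the second leg of the red
     spider. *)
  rewrite -(av ord0) -(bw ord_max).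
  by apply: etrans (etrans _ (congr1 (@^~ ord0) ab)) _;
    rewrite /rpart /=; apply: eq_at.
by exists v; split=> // i; rewrite yu -(cu ord0) cw.
Qed.

Lemma rule_coloring r n m (D E : diag n m) : r <> B1 -> rule r D E -> same_coloring D E.
Proof.
move=> rB1 DE; case: DE rB1 => {r n m D E} //.
- by move=> n m D E DE _; apply: same_connectivity_coloring.
- by move=> *; apply: S1_coloring.
- move=> _ x y /=; split=> [e|[v [_ yv]]]; last by rewrite !yv.
  exists (y ord0); split=> -[[|[|]]] //= i; first exact: eq_at.
  by rewrite e; apply: eq_at.
- by move=> _; apply: B2_coloring.
- by move=> _; apply: EU_coloring.
- move=> n m a _ x y /=; split; last first.
    move=> h; exists x; first exact/Had_pow_coloring.
    by exists y; [| exact/Had_pow_coloring].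
  by case=> z /Had_pow_coloring -> [t h /Had_pow_coloring <-].
(* For [IV] both sides are scalars: the empty families are equal, and colouring every inner wire
   [true] satisfies the left-hand side. *)
- move=> _ x y /=; split=> [_|_]; first by apply: functional_extensionality => -[].
  split; last first.
    by exists (fun=> true); exists true; split=> // -[].
  split; first by exists true; split=> -[].
  by exists (fun=> true); exists true; split=> // -[].
Qed.

Theorem lemma3p3 :
  ~ @derives (ZXsimp_without B1) 0 2
      ((RZ 1 0 0 ∘ RX 0 1 0) ⊗ (RZ 1 2 0 ∘ RX 0 1 0))
      (RX 0 1 0 ⊗ RX 0 1 0).
Proof.
have RS n m (D E : diag n m) :
    monoidal_axiom D E \/ ZXsimp_without B1 D E -> same_coloring D E.
  by case=> [|[r]]; [apply: monoidal_same_coloring | apply: rule_coloring].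
(* This colouring gives the two outputs different colours. The two separate red spiders accept it,
   whereas the green spider [RZ 1 2 0] joins both outputs and rejects it. *)
pose y (i : 'I_2) := i == ord0.
move/(same_coloring_closure RS)/(_ (fun=> true) y) => /= [_ h].
case: h => [|_ [z _ [v [_ yv]]]].
  by split; [exists (y ord0) | exists (y ord_max)];
    split=> [[]//|i]; rewrite /lpart /rpart /= (ord1 i); apply: eq_at.
by have := yv ord0; rewrite -(yv ord_max).
Qed.
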